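(* Let $\mathcal M$ be a von Neumann algebra acting on a finite-dimensional Hilbert space $h$, and let $P=(P_t)_{t\ge0}$ be a continuous, positive, identity-preserving semigroup on $\mathcal M$ with a faithful invariant density $\rho$, symmetric with respect to the scalar product $\langle f,g\rangle=\mathrm{tr}(\rho^{1/2}f^*\rho^{1/2}g)$. Let $c>0$ and $\beta>0$. Suppose that (LSI($c$)) $\;H(f)\le c\,\mathcal E(f,f)$ for all strictly positive $f\in\mathcal M$; and (WRC-$\beta$) $\;\beta\,\mathcal E(I_{2,1}(f),I_{2,1}(f))\le\mathcal E\big(\log(\rho^{1/2}f\rho^{1/2})-\log\rho,\;f\big)$ for all strictly positive $f\in\mathcal M$. Then the modified logarithmic Sobolev inequality with constant $\beta/(2c)$ holds: $$\frac{\beta}{2c}\,E(f)\le\mathcal E\big(\log(\rho^{1/2}f\rho^{1/2})-\log\rho,\;f\big)\qquad\text{for all strictly positive } f\in\mathcal M.$$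
   Context: $\mathrm{tr}$ is the usual trace on operators on $h$. The semigroup $P=(P_t)_{t\ge0}$ consists of linear maps $P_t:\mathcal M\to\mathcal M$ with $P_0=\mathrm{id}$, $P_{t+s}=P_tP_s$, $t\mapsto P_t$ continuous, $P_t(f)\ge0$ whenever $f\ge0$, and $P_t(\mathbf 1)=\mathbf 1$. The faithful invariant density $\rho\in\mathcal M$ is strictly positive (invertible) with $\mathrm{tr}(\rho)=1$ and $\mathrm{tr}(\rho P_tf)=\mathrm{tr}(\rho f)$ for all $t\ge 0$, $f\in\mathcal M$. Symmetry means $\langle P_tf,g\rangle=\langle f,P_tg\rangle$ for all $f,g\in\mathcal M$, $t\ge0$. $\mathcal L$ denotes the infinitesimal generator of $P$, and $$\mathcal E(f,g)=-\langle f,\mathcal Lg\rangle=-\mathrm{tr}(\rho^{1/2}f^*\rho^{1/2}\mathcal Lg).$$ Norms: $\|f\|_1=\mathrm{tr}(|\rho^{1/2}f\rho^{1/2}|)$ and $\|f\|_2=\langle f,f\rangle^{1/2}$. For strictly positive $f\in\mathcal M$ (i.e. $f\ge\varepsilon\mathbf 1$ for some $\varepsilon>0$), define $$I_{2,1}(f)=\rho^{-1/4}(\rho^{1/2}f\rho^{1/2})^{1/2}\rho^{-1/4},$$ $$T_2(f)=\rho^{-1/4}(\rho^{1/4}f\rho^{1/4})\log(\rho^{1/4}f\rho^{1/4})\rho^{-1/4}-\tfrac14(f\log\rho+\log\rho\, f),$$ $$H(f)=\langle f,T_2(f)\rangle-\|f\|_2^2\log\|f\|_2,$$ $$E(f)=\mathrm{tr}\big(\rho^{1/2}f\rho^{1/2}(\log(\rho^{1/2}f\rho^{1/2})-\log\rho)\big)-\|f\|_1\log\|f\|_1.$$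 $\log$ is the natural logarithm (functional calculus for operators). *)

(* Defs.v *)
(* The finite-dimensional Hilbert space is C^n over C = R[i], R : realType;
   operators on it are matrices, with adjoint A ^t*. *)
From HB Require Import structures.
From mathcomp Require Import all_boot all_order all_algebra complex.
From mathcomp Require Import all_classical all_reals all_analysis.
Set Implicit Arguments.
Unset Strict Implicit.
Unset Printing Implicit Defensive.
Import Order.TTheory GRing.Theory Num.Theory numFieldNormedType.Exports.
Local Open Scope classical_set_scope.
Local Open Scope ring_scope.
Local Open Scope complex_scope.
Local Open Scope sesquilinear_scope.

Section Operators.
Context {R : realType} {n : nat}.
Implicit Types (M : set 'M[R[i]]_n) (A B f g : 'M[R[i]]_n).

Definition commutant M : set 'M[R[i]]_n :=
  [set A | forall B, M B -> A *m B = B *m A].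

Record von_neumann_algebra M : Prop := {
  vna1 : M 1%:M;
  vna_lin : forall (a : R[i]) f g, M f -> M g -> M (a *: f + g);
  vnaM : forall f g, M f -> M g -> M (f *m g);
  vna_adj : forall f, M f -> M (f ^t*);
  vna_bicommutant : commutant (commutant M) = M }.

(* The order of R[i] is partial: 0 <= z says that z is real and nonnegative.
   Hence psdmx A forces A to be self-adjoint. *)
Definition psdmx A : Prop :=
  forall v : 'cV[R[i]]_n, 0 <= (v ^t* *m A *m v) ord0 ord0.

Definition strictly_positive A : Prop :=
  exists2 eps : R, 0 < eps & psdmx (A - (eps%:C)%:M).

(* phi(A) = U^-1 diag(phi(lambda_i)) U for a unitary diagonalization
   A = U^-1 diag(lambda_i) U of a self-adjoint A (whose eigenvalues are real);
   the result does not depend on the diagonalization. *)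
Definition fun_calculus (phi : R -> R) A : 'M[R[i]]_n :=
  invmx (spectralmx A)
  *m diag_mx (map_mx (fun z : R[i] => (phi (complex.Re z))%:C)
                     (spectral_diag A))
  *m spectralmx A.

Definition mxpow A (s : R) : 'M[R[i]]_n := fun_calculus (fun x => x `^ s) A.
Definition mxlog A : 'M[R[i]]_n := fun_calculus (@ln R) A.
Definition mxabs A : 'M[R[i]]_n := mxpow (A ^t* *m A) (1 / 2).

End Operators.

Section Semigroup.
Context {R : realType} {n : nat}.
Implicit Types (M : set 'M[R[i]]_n) (f g rho : 'M[R[i]]_n).
Implicit Type P : R -> 'M[R[i]]_n -> 'M[R[i]]_n.

(* P t is only constrained for 0 <= t and on M.  Pointwise continuity is
   continuity in operator norm, M being finite dimensional.  R[i] carries its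
   topology under the name (R[i])^o. *)
Record positive_unital_semigroup M P : Prop := {
  psg_stable : forall t f, 0 <= t -> M f -> M (P t f);
  psg_linear : forall t (a : R[i]) f g, 0 <= t -> M f -> M g ->
    P t (a *: f + g) = a *: P t f + P t g;
  psg0 : forall f, M f -> P 0 f = f;
  psgD : forall t s f, 0 <= t -> 0 <= s -> M f -> P (t + s) f = P t (P s f);
  psg_continuous : forall f, M f ->
    {within `[0, +oo[, continuous (fun t : R => P t f : 'M[(R[i])^o]_n)};
  psg_positive : forall t f, 0 <= t -> M f -> psdmx f -> psdmx (P t f);
  psg_unital : forall t, 0 <= t -> P t 1%:M = 1%:M }.

Record faithful_invariant_density M P rho : Prop := {
  fid_in : M rho;
  fid_positive : strictly_positive rho;
  fid_trace : \tr rho = 1;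
  fid_invariant : forall t f, 0 <= t -> M f ->
    \tr (rho *m P t f) = \tr (rho *m f) }.

Definition inner rho f g : R[i] :=
  \tr (mxpow rho (1 / 2) *m f ^t* *m mxpow rho (1 / 2) *m g).

Definition symmetric_semigroup M P rho : Prop :=
  forall t f g, 0 <= t -> M f -> M g ->
    inner rho (P t f) g = inner rho f (P t g).

(* For f in M the limit exists, since a continuous semigroup on a
   finite-dimensional space is differentiable. *)
Definition generator P f : 'M[R[i]]_n :=
  lim ((((t^-1)%:C *: (P t f - f) : 'M[(R[i])^o]_n)) @[t --> (0 : R)^'+]).

Definition dirichlet P rho f g : R[i] := - inner rho f (generator P g).

End Semigroup.

Section Entropy.
Context {R : realType} {n : nat}.
Implicit Types (f rho : 'M[R[i]]_n).

Definition sandwich rho f : 'M[R[i]]_n :=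
  mxpow rho (1 / 2) *m f *m mxpow rho (1 / 2).

Definition norm1 rho f : R := complex.Re (\tr (mxabs (sandwich rho f))).
Definition norm2 rho f : R := Num.sqrt (complex.Re (inner rho f f)).

Definition I21 rho f : 'M[R[i]]_n :=
  mxpow rho (- (1 / 4)) *m mxpow (sandwich rho f) (1 / 2)
  *m mxpow rho (- (1 / 4)).

Definition T2 rho f : 'M[R[i]]_n :=
  let X := mxpow rho (1 / 4) *m f *m mxpow rho (1 / 4) in
  mxpow rho (- (1 / 4)) *m (X *m mxlog X) *m mxpow rho (- (1 / 4))
  - (1 / 4) *: (f *m mxlog rho + mxlog rho *m f).

Definition H_ent rho f : R[i] :=
  inner rho f (T2 rho f) - (norm2 rho f ^+ 2 * ln (norm2 rho f))%:C.

Definition E_ent rho f : R[i] :=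
  \tr (sandwich rho f *m (mxlog (sandwich rho f) - mxlog rho))
  - (norm1 rho f * ln (norm1 rho f))%:C.

End Entropy.

(* Main.v *)
(* Apply LSI to g = I_{2,1}(f).  With S = rho^(1/2) f rho^(1/2) and X = S^(1/2)
   one has rho^(1/4) g rho^(1/4) = X, so by cyclicity of the trace
   ||g||_2^2 = tr S = ||f||_1 and <g, T_2 g> = tr (S (log S - log rho)) / 2;
   hence H(g) = E(f) / 2, and LSI at g followed by WRC at f gives the claim.
   That g lies in M follows from the bicommutant property, as the functional
   calculus of A commutes with everything commuting with A. *)
Require Import Defs.
From mathcomp Require Import all_boot all_order all_algebra complex ring.
From mathcomp Require Import all_classical all_reals all_analysis.
Import Order.TTheory GRing.Theory Num.Theory.
Local Open Scope classical_set_scope.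
Local Open Scope ring_scope.
Local Open Scope complex_scope.
Set Implicit Arguments.
Unset Strict Implicit.
Unset Printing Implicit Defensive.
Local Open Scope sesquilinear_scope.

(** * Adjoints and intertwiners of diagonal matrices *)

Lemma adjmxM (C : numClosedFieldType) m n p
    (A : 'M[C]_(m, n)) (B : 'M[C]_(n, p)) :
  (A *m B)^t* = B^t* *m A^t*.
Proof. by rewrite trmx_mul map_mxM. Qed.

Lemma adjmxB (C : numClosedFieldType) m n (A B : 'M[C]_(m, n)) :
  (A - B)^t* = A^t* - B^t*.
Proof. by rewrite linearB /= map_mxB. Qed.

(** Entrywise, the hypothesis says that [d] at [i] equals [e] at [j] wherever [W i j] is nonzero,
    and applying [phi] keeps these equalities. No polynomial interpolation of [phi] is involved. *)
Lemma diag_mx_intertwine (K : idomainType) m n (phi : K -> K) (d : 'rV[K]_m)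
    (e : 'rV[K]_n) (W : 'M[K]_(m, n)) :
  diag_mx d *m W = W *m diag_mx e ->
  diag_mx (map_mx phi d) *m W = W *m diag_mx (map_mx phi e).
Proof.
rewrite !mul_diag_mx !mul_mx_diag => /matrixP dW; apply/matrixP=> i j.
move: (dW i j); rewrite !mxE => dWij.
have [->|W0] := eqVneq (W i j) 0; first by rewrite mulr0 mul0r.
by rewrite mulrC; congr (_ * phi _); apply: (mulfI W0); rewrite -dWij mulrC.
Qed.

(** * Quadratic forms, positive definite matrices and unitary diagonalization *)

Section PositiveDefinite.
Context {C : numClosedFieldType} {n : nat}.
Implicit Types (A B U : 'M[C]_n) (v : 'cV[C]_n) (d e : 'rV[C]_n).
Implicit Types (phi psi chi : C -> C).

Definition qform A v : C := (v^t* *m A *m v) ord0 ord0.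

Lemma qformB A B v : qform (A - B) v = qform A v - qform B v.
Proof. by rewrite /qform mulmxBr mulmxBl !mxE. Qed.

Lemma qform_adj A v : qform (A^t*) v = ((qform A v)^*)%R.
Proof.
have -> : ((qform A v)^*)%R = ((v^t* *m A *m v)^t*) ord0 ord0.
  by rewrite [RHS]mxE [in RHS]mxE.
by rewrite !adjmxM trmxCK mulmxA.
Qed.

Lemma qform_congr A (K : 'M[C]_n) v :
  qform (K^t* *m A *m K) v = qform A (K *m v).
Proof. by rewrite /qform adjmxM !mulmxA. Qed.

Lemma qform_row A U i : qform A ((row i U)^t*) = (U *m A *m U^t*) i i.
Proof.
by rewrite /qform trmxCK -row_mul !mxE; apply: eq_bigr => k _; rewrite !mxE.
Qed.

Lemma qform_diag (d : 'rV[C]_n) v :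
  qform (diag_mx d) v = \sum_i d 0 i * `|v i 0| ^+ 2.
Proof.
rewrite /qform mul_mx_diag mxE; apply: eq_bigr => i _.
by rewrite !mxE mulrAC [RHS]mulrC normCKC.
Qed.

Lemma qform_scalar a v : qform a%:M v = a * qform 1%:M v.
Proof. by rewrite /qform mul_mx_scalar -scalemxAl mulmx1 mxE. Qed.

Lemma qform_diag_gt0 d v :
  (forall i, 0 < d 0 i) -> v != 0 -> 0 < qform (diag_mx d) v.
Proof.
move=> d0 v0.
have dv i : 0 <= d 0 i * `|v i 0| ^+ 2 by rewrite mulr_ge0 ?exprn_ge0// ltW.
rewrite qform_diag lt_def sumr_ge0// andbT.
apply: contraNneq v0 => /eqP; rewrite psumr_eq0// => /allP v0.
apply/eqP/colP=> i; move: (v0 i (mem_index_enum i)); rewrite !mxE /=.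
by rewrite mulf_eq0 gt_eqF//= expf_eq0 /= normr_eq0 => /eqP.
Qed.

Lemma qform1_gt0 v : v != 0 -> 0 < qform 1%:M v.
Proof.
by rewrite -diag_const_mx; apply: qform_diag_gt0 => i; rewrite mxE.
Qed.

Lemma unitarymxK U : U \is unitarymx -> U^t* *m U = 1%:M.
Proof. by move=> Uu; rewrite -invmx_unitary ?mulVmx ?unitarymx_unit. Qed.

(* A - A^t* is normal and its quadratic form vanishes, so its spectrum is 0. *)
Lemma qform_real_herm A :
  (forall v, qform A v \is Num.real) -> A^t* = A.
Proof.
move=> rA; set B := A - A^t*.
have B0 v : qform B v = 0.
  by rewrite qformB qform_adj (CrealP (rA v)) subrr.
have Bn : B \is normalmx.
  by apply/normalmxP; rewrite adjmxB trmxCK -opprB mulmxN mulNmx.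
have UU := unitarymxP (spectral_unitarymx B).
have /esym/eqP : B = 0.
  rewrite (orthomx_spectralP Bn).
  suff -> : spectral_diag B = 0 by rewrite raddf0 mulmx0 mul0mx.
  apply/rowP=> i; rewrite mxE.
  have := B0 ((row i (spectralmx B))^t*).
  rewrite qform_row {2}(orthomx_spectralP Bn).
  rewrite invmx_unitary ?spectral_unitarymx//.
  by rewrite !mulmxA UU mul1mx -mulmxA UU mulmx1 !mxE eqxx mulr1n.
by rewrite eq_sym subr_eq0 => /eqP <-.
Qed.

(** Self-adjointness is built in: positivity in the partial order of [C] makes the quadratic form
    real, whence [posdefmx_adj]. *)
Definition posdefmx A : Prop := forall v, v != 0 -> 0 < qform A v.

Lemma posdefmx_adj A : posdefmx A -> A^t* = A.
Proof.
move=> A0; apply: qform_real_herm => v; apply: ger0_real.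
have [->|/A0/ltW//] := eqVneq v 0.
by rewrite /qform mulmx0 mxE.
Qed.

Lemma posdefmx_normal A : posdefmx A -> A \is normalmx.
Proof. by move=> A0; apply/normalmxP; rewrite posdefmx_adj. Qed.

Lemma posdefmx_congr A (K : 'M[C]_n) :
  posdefmx A -> K \in unitmx -> posdefmx (K^t* *m A *m K).
Proof.
move=> A0 uK v v0; rewrite qform_congr A0//.
by apply: contra_neq v0 => Kv; rewrite -(mulKmx uK v) Kv mulmx0.
Qed.

(** An arbitrary unitary [U] is allowed, not only [spectralmx], so that one diagonalization can
    serve all functions of the same matrix. *)
Definition udiag U d : 'M[C]_n := U^t* *m diag_mx d *m U.

Lemma udiagM U d e : U \is unitarymx ->
  udiag U d *m udiag U e = udiag U (\row_i (d 0 i * e 0 i)).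
Proof.
move=> /unitarymxP UU; rewrite /udiag !mulmxA -(mulmxA _ U) UU mulmx1.
by rewrite -[_ *m diag_mx _ *m diag_mx _]mulmxA mulmx_diag.
Qed.

Lemma udiag1 U : U \is unitarymx -> udiag U (const_mx 1) = 1%:M.
Proof. by move=> /unitarymxK UU; rewrite /udiag diag_const_mx mulmx1. Qed.

Lemma udiagZ U a d : udiag U (a *: d) = a *: udiag U d.
Proof. by rewrite /udiag linearZ /= scalemxAl scalemxAr. Qed.

Lemma udiag_tr U d : U \is unitarymx -> \tr (udiag U d) = \sum_i d 0 i.
Proof.
move=> /unitarymxP UU.
by rewrite /udiag mxtrace_mulC mulmxA UU mul1mx mxtrace_diag.
Qed.

Lemma udiag_posdefmx U d : U \is unitarymx ->
  (forall i, 0 < d 0 i) -> posdefmx (udiag U d).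
Proof.
move=> Uu d0; apply: posdefmx_congr; last exact: unitarymx_unit.
by move=> v; exact: qform_diag_gt0.
Qed.

Lemma qform_udiag_ge U d a v : U \is unitarymx ->
  (forall i, a <= d 0 i) -> qform a%:M v <= qform (udiag U d) v.
Proof.
move=> Uu ad; have -> : a%:M = U^t* *m a%:M *m U.
  by rewrite mul_mx_scalar -scalemxAl unitarymxK// scalemx1.
rewrite /udiag !qform_congr -diag_const_mx !qform_diag ler_sum// => i _.
by rewrite mxE ler_wpM2r ?exprn_ge0.
Qed.

Lemma posdefmx_udiag A : posdefmx A ->
  exists U d, [/\ U \is unitarymx, forall i, 0 < d 0 i & A = udiag U d].
Proof.
move=> A0; have An := posdefmx_normal A0.
have Uu := spectral_unitarymx A; have UU := unitarymxP Uu.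
set U := spectralmx A in Uu UU *; set d := spectral_diag A.
have AE : A = udiag U d.
  by rewrite /udiag -invmx_unitary//; exact: orthomx_spectralP.
(* Each eigenvalue is the quadratic form at its eigenvector, the adjoint of a row of [U]; this
   vector is nonzero because it has norm 1. *)
exists U, d; split => // i; suff <- : qform A ((row i U)^t*) = d 0 i.
  apply: A0; apply: contra_eq_neq (esym (qform_row 1%:M U i)) => ->.
  by rewrite mulmx1 UU mxE eqxx /qform mulmx0 mxE oner_neq0.
rewrite qform_row AE /udiag.
by rewrite !mulmxA UU mul1mx -mulmxA UU mulmx1 !mxE eqxx mulr1n.
Qed.

Lemma posdefmx_tr_ge0 A : posdefmx A -> 0 <= \tr A.
Proof.
move=> /posdefmx_udiag[U [d [Uu d0 ->]]]; rewrite udiag_tr//.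
by apply: sumr_ge0 => i _; exact: ltW.
Qed.

(** * Functional calculus on normal and positive definite matrices *)

Definition mxcalc phi A : 'M[C]_n :=
  invmx (spectralmx A) *m diag_mx (map_mx phi (spectral_diag A))
  *m spectralmx A.

(** In the eigenbases of [A] and [B], [X] becomes a matrix intertwining two diagonal ones, to which
    [diag_mx_intertwine] applies. For [A = B] this says that the calculus of [A] commutes with all
    that commutes with [A]. *)
Lemma mxcalc_intertwine phi A B (X : 'M[C]_n) :
  A \is normalmx -> B \is normalmx -> A *m X = X *m B ->
  mxcalc phi A *m X = X *m mxcalc phi B.
Proof.
move=> /orthomx_spectralP dA /orthomx_spectralP dB AX; rewrite /mxcalc.
set U := spectralmx A in dA *; set V := spectralmx B in dB *.
have uU : U \in unitmx := spectral_unit A.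
have uV : V \in unitmx := spectral_unit B.
have DW : diag_mx (spectral_diag A) *m (U *m X *m invmx V)
    = U *m X *m invmx V *m diag_mx (spectral_diag B).
  move/(congr1 (fun Y => U *m Y *m invmx V)): AX.
  by rewrite {1}dA {1}dB !mulmxA mulmxV// mul1mx mulmxK.
move/(diag_mx_intertwine phi)/(congr1 (fun Y => invmx U *m Y *m V)): DW.
by rewrite !mulmxA mulVmx// mul1mx mulmxKV.
Qed.

(** Independence of the diagonalization: the change of basis from [U] to [spectralmx] intertwines
    the two diagonal forms, hence also their images under [phi]. *)
Lemma mxcalc_udiag phi U d : U \is unitarymx -> udiag U d \is normalmx ->
  mxcalc phi (udiag U d) = udiag U (map_mx phi d).
Proof.
move=> Uu; have UU := unitarymxP Uu; set A := udiag U d => dA.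
set V := spectralmx A; have uV : V \in unitmx := spectral_unit A.
have DW : diag_mx (spectral_diag A) *m (V *m U^t*) = V *m U^t* *m diag_mx d.
  have /(congr1 (fun Y => V *m Y *m U^t*)) := orthomx_spectralP dA.
  rewrite {1}/A /udiag -/V !mulmxA mulmxV// mul1mx.
  by rewrite -[_ *m U *m _]mulmxA UU mulmx1.
move/(diag_mx_intertwine phi)/(congr1 (fun Y => invmx V *m Y *m U)): DW.
rewrite !mulmxA mulVmx// mul1mx.
by rewrite -[_ *m U^t* *m U]mulmxA unitarymxK// mulmx1.
Qed.

Section MxcalcPosdef.
Variable A : 'M[C]_n.
Hypothesis A0 : posdefmx A.

Lemma mxcalc_posdefmx phi : (forall x, 0 < x -> 0 < phi x) ->
  posdefmx (mxcalc phi A).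
Proof.
move=> phi0; have An := posdefmx_normal A0.
have [U [d [Uu d0 AE]]] := posdefmx_udiag A0; rewrite AE in An *.
by rewrite mxcalc_udiag//; apply: udiag_posdefmx => // i; rewrite mxE phi0.
Qed.

Lemma mxcalcM phi psi chi : (forall x, 0 < x -> phi x * psi x = chi x) ->
  mxcalc phi A *m mxcalc psi A = mxcalc chi A.
Proof.
move=> phipsi; have An := posdefmx_normal A0.
have [U [d [Uu d0 AE]]] := posdefmx_udiag A0; rewrite AE in An *.
rewrite !mxcalc_udiag// udiagM//; congr udiag.
by apply/rowP=> i; rewrite !mxE phipsi.
Qed.

Lemma mxcalc1 phi : (forall x, 0 < x -> phi x = 1) -> mxcalc phi A = 1%:M.
Proof.
move=> phi1; have An := posdefmx_normal A0.
have [U [d [Uu d0 AE]]] := posdefmx_udiag A0; rewrite AE in An *.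
rewrite mxcalc_udiag// -(udiag1 Uu); congr udiag.
by apply/rowP=> i; rewrite !mxE phi1.
Qed.

Lemma mxcalc_id phi : (forall x, 0 < x -> phi x = x) -> mxcalc phi A = A.
Proof.
move=> phi1; have An := posdefmx_normal A0.
have [U [d [Uu d0 AE]]] := posdefmx_udiag A0; rewrite AE in An *.
by rewrite mxcalc_udiag//; congr udiag; apply/rowP=> i; rewrite !mxE phi1.
Qed.

(** The scalar [a] accommodates the rule that the logarithm of a power [s] is [s] times the
    logarithm. *)
Lemma mxcalc_comp phi psi chi a : (forall x, 0 < x -> 0 < psi x) ->
  (forall x, 0 < x -> phi (psi x) = a * chi x) ->
  mxcalc phi (mxcalc psi A) = a *: mxcalc chi A.
Proof.
move=> psi0 phipsi; have Pn := posdefmx_normal (mxcalc_posdefmx psi0).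
have An := posdefmx_normal A0.
have [U [d [Uu d0 AE]]] := posdefmx_udiag A0; rewrite AE in An Pn *.
move: Pn; rewrite !(mxcalc_udiag _ Uu An) => Pn.
rewrite mxcalc_udiag// -udiagZ; congr udiag.
by apply/rowP=> i; rewrite !mxE phipsi.
Qed.

End MxcalcPosdef.

End PositiveDefinite.

Lemma mxtraceB (K : pzRingType) n (A B : 'M[K]_n) :
  \tr (A - B) = \tr A - \tr B.
Proof. exact: raddfB. Qed.

(** * Cancellations under the trace; [p], [q], [L] model the powers 1/4 and -1/4 of [rho] and its
    logarithm *)

Section TraceIdentities.
Context {K : comPzRingType} {n : nat}.
Variables p q X Y L : 'M[K]_n.
Hypotheses (pq : p *m q = 1%:M) (qp : q *m p = 1%:M) (pL : p *m L = L *m p)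
  (qL : q *m L = L *m q).

Lemma mulmx_cancel_sandwich : p *m (q *m X *m q) *m p = X.
Proof. by rewrite !mulmxA pq mul1mx -mulmxA qp mulmx1. Qed.

Lemma mulmx_sandwich2 :
  p *m p *m (q *m X *m q) *m (p *m p) = p *m X *m p.
Proof.
by rewrite !mulmxA -(mulmxA p p) pq mulmx1 -(mulmxA _ q) qp mulmx1.
Qed.

Lemma mxtrace_sandwich :
  \tr (p *m X *m p *m (q *m Y *m q)) = \tr (X *m Y).
Proof.
by rewrite !mulmxA -(mulmxA _ p) pq mulmx1 mxtrace_mulC !mulmxA qp mul1mx.
Qed.

Lemma mxtrace_sandwich_commr :
  \tr (p *m X *m p *m (q *m X *m q *m L)) = \tr (X *m X *m L).
Proof.
rewrite -(mulmxA (q *m X)) qL !mulmxA -(mulmxA _ p) pq mulmx1.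
by rewrite mxtrace_mulC !mulmxA qp mul1mx.
Qed.

(** Moving [L] left past [p] frees the product of [p] and [q]; [L] is then caught between the two
    copies of [X], and cyclicity takes it to the end. *)
Lemma mxtrace_sandwich_comml :
  \tr (p *m X *m p *m (L *m (q *m X *m q))) = \tr (X *m X *m L).
Proof.
rewrite !mulmxA -(mulmxA (p *m X)) pL !mulmxA -(mulmxA _ p q) pq mulmx1.
rewrite mxtrace_mulC !mulmxA qp mul1mx -mulmxA mxtrace_mulC.
by rewrite -mulmxA mxtrace_mulC.
Qed.

End TraceIdentities.

(** * Strictly positive operators, their real powers and logarithm *)

Section StrictlyPositive.
Context {R : realType} {n : nat}.
Implicit Types (M : set 'M[R[i]]_n) (A B : 'M[R[i]]_n).

Lemma gt0_complexP (z : R[i]) : 0 < z -> exists2 x : R, 0 < x & z = x%:C.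
Proof.
by case: z => x y; rewrite ltcE /= => /andP[/eqP -> x0]; exists x.
Qed.

Lemma strictly_positiveP A : strictly_positive A <-> posdefmx A.
Proof.
split=> [[eps eps0 Ae] v v0|].
  have := Ae v; rewrite -/(qform _ v) qformB qform_scalar subr_ge0.
  by apply: lt_le_trans; rewrite mulr_gt0 ?qform1_gt0// ltcR.
move=> /posdefmx_udiag[U [d [Uu d0 ->]]].
(* The witness is the least eigenvalue capped at 1; the cap keeps it positive even when [n] is 0. *)
exists (\big[Order.min/1]_i complex.Re (d 0 i)) => [|v].
  apply/bigmin_gtP; split => // i _.
  by have [x x0 ->] := gt0_complexP (d0 i).
rewrite -/(qform _ v) qformB subr_ge0; apply: qform_udiag_ge => // i.
have := bigmin_le 1 i (fun i => complex.Re (d 0 i)).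
by have [x x0 ->] := gt0_complexP (d0 i); rewrite lecR.
Qed.

Section FunCalculus.
Variable A : 'M[R[i]]_n.
Hypothesis A0 : posdefmx A.

Lemma mxpow_posdefmx s : posdefmx (mxpow A s).
Proof.
apply: mxcalc_posdefmx => // _ /gt0_complexP[x x0 ->].
by rewrite ltcR powR_gt0.
Qed.

Lemma mxpowD s t : mxpow A s *m mxpow A t = mxpow A (s + t).
Proof.
apply: mxcalcM => // _ /gt0_complexP[x x0 ->] /=.
by rewrite -rmorphM -powRD// (gt_eqF x0) implybT.
Qed.

Lemma mxpow0 : mxpow A 0 = 1%:M.
Proof. by apply: mxcalc1 => // _ /gt0_complexP[x x0 ->]; rewrite powRr0. Qed.

Lemma mxpow1 : mxpow A 1 = A.
Proof.
by apply: mxcalc_id => // _ /gt0_complexP[x x0 ->]; rewrite powRr1// ltW.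
Qed.

Lemma mxpowV s : mxpow A s *m mxpow A (- s) = 1%:M.
Proof. by rewrite mxpowD subrr mxpow0. Qed.

Lemma mxpow_unit s : mxpow A s \in unitmx.
Proof. exact: (mulmx1_unit (mxpowV s)).1. Qed.

Lemma mxlog_mxpow s : mxlog (mxpow A s) = s%:C *: mxlog A.
Proof.
apply: mxcalc_comp => // _ /gt0_complexP[x x0 ->] /=.
  by rewrite ltcR powR_gt0.
by rewrite ln_powR rmorphM.
Qed.

Lemma mxpow_mxlogC s : mxpow A s *m mxlog A = mxlog A *m mxpow A s.
Proof.
(* Both products are the calculus of the same scalar function [chi]. *)
pose chi (z : R[i]) := (complex.Re z `^ s)%:C * (ln (complex.Re z))%:C.
transitivity (mxcalc chi A); [|symmetry]; apply: mxcalcM => // z _.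
by rewrite mulrC.
Qed.

Lemma mxabs_posdefmx : mxabs A = A.
Proof.
(* The square of [A] is presented as a power of [A], so that its square root becomes a composition
   of two calculi, with [a] equal to 1. *)
rewrite /mxabs posdefmx_adj// -{1 2}mxpow1 mxpowD /mxpow.
rewrite -[RHS]mxpow1 -[RHS]scale1r; apply: mxcalc_comp => //.
  by move=> _ /gt0_complexP[x x0 ->]; rewrite ltcR powR_gt0.
move=> _ /gt0_complexP[x x0 ->] /=.
by rewrite -powRrM [RHS]mul1r; congr (_ `^ _)%:C; field.
Qed.

Lemma fun_calculus_vna M (phi : R -> R) : von_neumann_algebra M ->
  M A -> M (fun_calculus phi A).
Proof.
(* [B] ranges over the commutant of [M], so it commutes with [A]. *)
move=> vM MA; rewrite -(vna_bicommutant vM) => B MB.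
have An := posdefmx_normal A0.
by apply: mxcalc_intertwine => //; rewrite MB.
Qed.

End FunCalculus.

Implicit Types rho f : 'M[R[i]]_n.

(** * The operator [I21 rho f] and its entropy *)

Lemma sandwich_posdefmx rho f :
  posdefmx rho -> posdefmx f -> posdefmx (sandwich rho f).
Proof.
move=> r0 f0; have r2 := mxpow_posdefmx r0 (1 / 2).
rewrite /sandwich -{1}(posdefmx_adj r2).
exact/posdefmx_congr/mxpow_unit.
Qed.

Lemma I21_posdefmx rho f :
  posdefmx rho -> posdefmx f -> posdefmx (I21 rho f).
Proof.
move=> r0 f0; have r4 := mxpow_posdefmx r0 (- (1 / 4)).
rewrite /I21 -{1}(posdefmx_adj r4).
apply: posdefmx_congr; last exact: mxpow_unit.
exact/mxpow_posdefmx/sandwich_posdefmx.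
Qed.

Lemma I21_vna M rho f : von_neumann_algebra M ->
  posdefmx rho -> posdefmx f -> M rho -> M f -> M (I21 rho f).
Proof.
move=> vM r0 f0 Mr Mf.
have Mrs s : M (mxpow rho s) := fun_calculus_vna r0 _ vM Mr.
have MM g h : M g -> M h -> M (g *m h) := @vnaM _ _ _ vM g h.
have MS := MM _ _ (MM _ _ (Mrs (1 / 2)) Mf) (Mrs (1 / 2)).
have MX :=
  fun_calculus_vna (sandwich_posdefmx r0 f0) (fun x => x `^ (1 / 2)) vM MS.
exact: (MM _ _ (MM _ _ (Mrs _) MX) (Mrs _)).
Qed.

(** The factor 1/2 has three sources: the logarithm of a square root is half the logarithm; the two
    terms of [T2] with weight 1/4 have equal traces against [I21 rho f]; and [norm2] is the square
    root of [norm1], so its logarithm is halved. *)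
Lemma H_ent_I21 rho f : posdefmx rho -> posdefmx f ->
  H_ent rho (I21 rho f) = (2^-1)%:C * E_ent rho f.
Proof.
move=> r0 f0; have S0 := sandwich_posdefmx r0 f0.
rewrite /H_ent /E_ent /norm2 /norm1 (mxabs_posdefmx S0) /inner.
rewrite (posdefmx_adj (I21_posdefmx r0 f0)) /T2 /I21.
set S := sandwich rho f in S0 *; set X := mxpow S (1 / 2).
set p := mxpow rho (1 / 4); set q := mxpow rho (- (1 / 4)).
have pq : p *m q = 1%:M := mxpowV r0 _.
have qp : q *m p = 1%:M := mulmx1C pq.
have pL : p *m mxlog rho = mxlog rho *m p := mxpow_mxlogC r0 _.
have qL : q *m mxlog rho = mxlog rho *m q := mxpow_mxlogC r0 _.
have -> : mxpow rho (1 / 2) = p *m p.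
  by rewrite (mxpowD r0); congr mxpow; field.
have XX : X *m X = S.
  by rewrite (mxpowD S0) -[RHS](mxpow1 S0); congr mxpow; field.
have logX : mxlog X = (2^-1)%:C *: mxlog S.
  by rewrite (mxlog_mxpow S0) div1r.
have trS := posdefmx_tr_ge0 S0.
(* Otherwise unification unfolds p and q and compares real exponents. *)
clearbody p q X; clearbody S.
have XE := mulmx_cancel_sandwich X pq qp.
rewrite XE logX.
move: (mxlog S) (mxlog rho) pL qL => LS L pL qL.
rewrite (mulmx_sandwich2 X pq qp).
rewrite mulmxBr mxtraceB -!scalemxAr -scalemxAl -scalemxAr !mxtraceZ.
rewrite mulmxDr mxtraceD.
rewrite (mxtrace_sandwich X X pq qp) (mxtrace_sandwich X _ pq qp).
rewrite (mxtrace_sandwich_commr X pq qp qL).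
rewrite (mxtrace_sandwich_comml X pq qp pL).
rewrite mulmxBr mxtraceB (mulmxA X X LS) XX.
(* Since the trace of [S] is real and nonnegative, taking its real part in the norms loses nothing,
   and squaring [norm2] returns [t]. *)
have trE := RRe_real (ger0_real trS); set t := complex.Re _ in trE *.
have t0 : 0 <= t by rewrite -ler0c trE.
rewrite (sqr_sqrtr t0) -(powR12_sqrt t0) ln_powR mulrCA rmorphM /=.
have -> : (2^-1)%:C = 2^-1 :> R[i] by rewrite fmorphV rmorph_nat.
move: (\tr (S *m LS)) (\tr (S *m L)) (t * ln t)%:C => a b r.
by field.
Qed.

End StrictlyPositive.

Theorem proposition13 (R : realType) (n : nat)
    (M : set 'M[R[i]]_n) (P : R -> 'M[R[i]]_n -> 'M[R[i]]_n)
    (rho : 'M[R[i]]_n) (c beta : R)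
    (M_vna : von_neumann_algebra M)
    (P_psg : positive_unital_semigroup M P)
    (rho_fid : faithful_invariant_density M P rho)
    (P_sym : symmetric_semigroup M P rho)
    (c_gt0 : 0 < c) (beta_gt0 : 0 < beta)
    (LSI : forall f, M f -> strictly_positive f ->
      H_ent rho f <= c%:C * dirichlet P rho f f)
    (WRC : forall f, M f -> strictly_positive f ->
      beta%:C * dirichlet P rho (I21 rho f) (I21 rho f)
        <= dirichlet P rho (mxlog (sandwich rho f) - mxlog rho) f) :
  forall f, M f -> strictly_positive f ->
    (beta / (2 * c))%:C * E_ent rho f
      <= dirichlet P rho (mxlog (sandwich rho f) - mxlog rho) f.
Proof.
move=> f Mf f0; have Mr := fid_in rho_fid.
have r0 := (strictly_positiveP rho).1 (fid_positive rho_fid).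
have fp := (strictly_positiveP f).1 f0.
apply: le_trans (WRC _ Mf f0).
have g0 := (strictly_positiveP _).2 (I21_posdefmx r0 fp).
have := LSI _ (I21_vna M_vna r0 fp Mr Mf) g0; rewrite (H_ent_I21 r0 fp).
set g := I21 rho f; move: (E_ent rho f) (dirichlet P rho g g) => e D HE.
(* Scaling LSI by [beta / c] turns its right side into the left side of WRC; with the 1/2 from
   [H_ent_I21] the constant is [beta / (2 * c)]. *)
have bc : 0 <= (beta / c)%:C by rewrite ler0c divr_ge0// ltW.
have := ler_wpM2l bc HE; rewrite !mulrA -!rmorphM /=.
have -> : beta / c / 2 = beta / (2 * c) by field; rewrite gt_eqF.
by rewrite divfK// gt_eqF.
Qed.
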